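(* The theory of the structure $\langle\mathbb{R}^{\geqslant 0},0,1,\cdot,{}^{-1}\rangle$ admits quantifier elimination.
   Context: $\mathbb{R}^{\geqslant 0}$ is the set of nonnegative real numbers with constants $0,1$, ordinary multiplication, and ${}^{-1}$ given by $x^{-1}=1/x$ for $x\neq 0$ and $0^{-1}=0$. *)

(* Defs.v *)
From mathcomp Require Import all_boot all_order all_algebra.
From mathcomp Require Import reals.

Set Implicit Arguments.
Unset Strict Implicit.
Unset Printing Implicit Defensive.

Import Order.TTheory GRing.Theory Num.Theory.
Local Open Scope ring_scope.

(* First-order logic with equality over the signature (0, 1, ., ^-1);         *)
(* variables are named by natural numbers.                                    *)

Inductive term : Type :=
| TVar of nat
| TZero
| TOne
| TMul of term & term
| TInv of term.

Inductive formula : Type :=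
| FFalse
| FEq of term & term
| FNot of formula
| FAnd of formula & formula
| FOr of formula & formula
| FImp of formula & formula
| FAll of nat & formula
| FEx of nat & formula.

Definition FIff (p q : formula) : formula := FAnd (FImp p q) (FImp q p).

Fixpoint term_vars (t : term) : seq nat :=
  match t with
  | TVar n => [:: n]
  | TZero | TOne => [::]
  | TMul t u => term_vars t ++ term_vars u
  | TInv t => term_vars t
  end.

Fixpoint free_vars (p : formula) : seq nat :=
  match p with
  | FFalse => [::]
  | FEq t u => term_vars t ++ term_vars u
  | FNot p => free_vars p
  | FAnd p q | FOr p q | FImp p q => free_vars p ++ free_vars q
  | FAll n p | FEx n p => [seq m <- free_vars p | m != n]
  end.

Definition sentence (p : formula) : Prop := free_vars p = [::].

Fixpoint quantifier_free (p : formula) : bool :=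
  match p with
  | FFalse | FEq _ _ => true
  | FNot p => quantifier_free p
  | FAnd p q | FOr p q | FImp p q => quantifier_free p && quantifier_free q
  | FAll _ _ | FEx _ _ => false
  end.

(* The carrier is automatically nonempty, as it interprets the constants. *)
Record structure : Type := Structure {
  carrier :> Type;
  zero_ : carrier;
  one_ : carrier;
  mul_ : carrier -> carrier -> carrier;
  inv_ : carrier -> carrier
}.

Definition update (T : Type) (s : nat -> T) (n : nat) (a : T) : nat -> T :=
  fun m => if m == n then a else s m.

Fixpoint eval (M : structure) (s : nat -> M) (t : term) : M :=
  match t with
  | TVar n => s n
  | TZero => zero_ M
  | TOne => one_ M
  | TMul t u => mul_ (eval s t) (eval s u)
  | TInv t => inv_ (eval s t)
  end.

Fixpoint holds (M : structure) (s : nat -> M) (p : formula) : Prop :=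
  match p with
  | FFalse => False
  | FEq t u => eval s t = eval s u
  | FNot p => ~ holds s p
  | FAnd p q => holds s p /\ holds s q
  | FOr p q => holds s p \/ holds s q
  | FImp p q => holds s p -> holds s q
  | FAll n p => forall a : M, holds (update s n a) p
  | FEx n p => exists a : M, holds (update s n a) p
  end.

Definition satisfies (M : structure) (p : formula) : Prop :=
  forall s : nat -> M, holds s p.

Definition theory_of (M : structure) : formula -> Prop :=
  fun p => sentence p /\ satisfies M p.

Definition model_of (T : formula -> Prop) (M : structure) : Prop :=
  forall p : formula, T p -> satisfies M p.

Definition entails (T : formula -> Prop) (p : formula) : Prop :=
  forall M : structure, model_of T M -> satisfies M p.

Definition admits_quantifier_elimination (T : formula -> Prop) : Prop :=
  forall p : formula, exists q : formula,
    [/\ quantifier_free q,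
        {subset free_vars q <= free_vars p}
      & entails T (FIff p q)].

Section NonnegativeReals.
Variable R : realType.

Definition nnreal : Type := {x : R | 0 <= x}.

Definition nnreal0 : nnreal := exist _ 0 (lexx 0).

Definition nnreal1 : nnreal := exist _ 1 ler01.

Definition nnreal_mul (x y : nnreal) : nnreal :=
  exist _ (val x * val y) (mulr_ge0 (valP x) (valP y)).

Lemma nnreal_inv_subproof (x : nnreal) : 0 <= (val x)^-1.
Proof. by rewrite invr_ge0 (valP x). Qed.

Definition nnreal_inv (x : nnreal) : nnreal :=
  exist _ (val x)^-1 (nnreal_inv_subproof x).

(* The inverse of a field is total, with the required value at 0. *)
Lemma val_nnreal_inv (x : nnreal) :
  val (nnreal_inv x) = if val x == 0 then 0 else 1 / val x.
Proof. by rewrite /= div1r; case: eqP => // ->; rewrite invr0. Qed.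

Definition nnreal_structure : structure :=
  Structure nnreal0 nnreal1 nnreal_mul nnreal_inv.

End NonnegativeReals.

(* Main.v *)
Require Import Defs.
From mathcomp Require Import all_boot all_order all_algebra.
From mathcomp Require Import reals boolp.
From Stdlib Require List.

Set Implicit Arguments.
Unset Strict Implicit.
Unset Printing Implicit Defensive.

Import Order.TTheory GRing.Theory Num.Theory.
Local Open Scope ring_scope.

(** The theory of a structure is complete, so an equivalence valid in the
    nonnegative reals transfers to all models through its universal closure, and
    it is enough to eliminate one quantifier [FEx x p], [p] quantifier-free, over
    the nonnegative reals themselves.  For [x != 0] every atom can be written
    [x ^ i * U = x ^ j * V] with [U], [V] free of [x].  Unless [i = j] or one of
    [U], [V] vanishes, it holds at exactly one point, the root of [x ^ m = W]
    with [m = |i - j|] and [W] equal to [V / U] or [U / V].  So [p] has a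
    solution iff it holds at [0], or at one of these roots, or at a generic
    point, where the remaining atoms are all false.  At a root of [x ^ m = W]
    the truth of an atom is found by raising both sides to the power [m], which
    is injective on nonnegative reals; this needs no quantifier. *)

(** * Reduction to a single model *)

Lemma eval_ext (M : structure) (s s' : nat -> M) t :
  s =1 s' -> eval s t = eval s' t.
Proof. by move=> ss'; elim: t => //= [t -> u ->|t ->]. Qed.

Lemma holds_ext (M : structure) p (s s' : nat -> M) :
  s =1 s' -> holds s p <-> holds s' p.
Proof.
elim: p s s' => [|t u|p IH|p IHp q IHq|p IHp q IHq|p IHp q IHq|n p IH|n p IH] //=
  s s' ss'.
- by rewrite !(eval_ext _ ss').
- by have := IH _ _ ss'; tauto.
- by have := IHp _ _ ss'; have := IHq _ _ ss'; tauto.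
- by have := IHp _ _ ss'; have := IHq _ _ ss'; tauto.
- by have := IHp _ _ ss'; have := IHq _ _ ss'; tauto.
- have E a : update s n a =1 update s' n a by move=> m; rewrite /update ss'.
  by split=> H a; apply/(IH _ _ (E a)).
- have E a : update s n a =1 update s' n a by move=> m; rewrite /update ss'.
  by split=> -[a H]; exists a; apply/(IH _ _ (E a)).
Qed.

Definition universal_closure (p : formula) : formula :=
  foldr FAll p (free_vars p).

Lemma free_vars_FAlls l p :
  free_vars (foldr FAll p l) = [seq m <- free_vars p | m \notin l].
Proof.
elim: l => [|n l IH] /=; first by rewrite filter_predT.
by rewrite IH -filter_predI; apply: eq_filter => m; rewrite /= inE negb_or.
Qed.

Lemma sentence_universal_closure p : sentence (universal_closure p).
Proof.
rewrite /sentence free_vars_FAlls -(filter_pred0 (free_vars p)).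
by apply: eq_in_filter => m /= ->.
Qed.

(** Instantiating the bound variable by its present value recovers the body, and [satisfies] already
    ranges over all assignments; hence [l] may be any list. *)
Lemma satisfies_FAlls (M : structure) l p :
  satisfies M (foldr FAll p l) <-> satisfies M p.
Proof.
elim: l => //= n l <-; split=> H s; last by move=> a; apply: H.
have /holds_ext H' := H s (s n); apply/H' => m.
by rewrite /update; case: eqP => [->|].
Qed.

Lemma entails_theory_of (M : structure) p :
  satisfies M p -> entails (theory_of M) p.
Proof.
move=> Mp N NT; apply/(satisfies_FAlls _ (free_vars p)).
apply: NT; split; first exact: sentence_universal_closure.
exact/satisfies_FAlls.
Qed.

(** * Atoms of quantifier-free formulas *)

(** The last branch is correct for [FFalse]; on quantified formulas it is a filler that keeps the
    result quantifier-free. *)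
Fixpoint map_atoms (f : term -> term -> formula) (p : formula) : formula :=
  match p with
  | FEq t u => f t u
  | FNot p => FNot (map_atoms f p)
  | FAnd p q => FAnd (map_atoms f p) (map_atoms f q)
  | FOr p q => FOr (map_atoms f p) (map_atoms f q)
  | FImp p q => FImp (map_atoms f p) (map_atoms f q)
  | _ => FFalse
  end.

Fixpoint atoms (p : formula) : seq (term * term) :=
  match p with
  | FEq t u => [:: (t, u)]
  | FNot p => atoms p
  | FAnd p q | FOr p q | FImp p q => atoms p ++ atoms q
  | _ => [::]
  end.

Lemma In_cat (T : Type) (a : T) l1 l2 :
  List.In a (l1 ++ l2) <-> List.In a l1 \/ List.In a l2.
Proof. exact: List.in_app_iff. Qed.

Lemma atoms_free_vars p t u : List.In (t, u) (atoms p) -> quantifier_free p ->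
  {subset term_vars t ++ term_vars u <= free_vars p}.
Proof.
elim: p => [|t' u'|p IH|p IHp q IHq|p IHp q IHq|p IHp q IHq|n p IH|n p IH] //=.
- case=> [[-> ->] _ m|[]]; exact.
all: move=> /In_cat H /andP[hp hq] m Hm; rewrite mem_cat; case: H => H.
all: by rewrite ?(IHp H hp _ Hm) // (IHq H hq _ Hm) orbT.
Qed.

Lemma map_atoms_quantifier_free f p :
  (forall t u, quantifier_free (f t u)) -> quantifier_free (map_atoms f p).
Proof. by move=> Hf; elim: p => //= p -> q ->. Qed.

Lemma map_atoms_free_vars f p (A : {pred nat}) : quantifier_free p ->
  (forall t u, List.In (t, u) (atoms p) -> {subset free_vars (f t u) <= A}) ->
  {subset free_vars (map_atoms f p) <= A}.
Proof.
elim: p => [|t' u'|p IH|p IHp q IHq|p IHp q IHq|p IHp q IHq|n p IH|n p IH] //=.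
- by move=> _; apply; left.
all: move=> /andP[hp hq] H m; rewrite mem_cat => /orP[];
  [apply: (IHp hp) | apply: (IHq hq)] => t u I; apply: H; apply/In_cat; tauto.
Qed.

(** Later [s'] is [update s x c], while the new atoms, free of [x], are read under [s]. Asking for
    the equivalence only on the atoms of [p] matters: a generic point avoids only their roots. *)
Lemma holds_map_atoms (M : structure) (s s' : nat -> M) f p :
  quantifier_free p ->
  (forall t u, List.In (t, u) (atoms p) ->
     holds s (f t u) <-> eval s' t = eval s' u) ->
  holds s (map_atoms f p) <-> holds s' p.
Proof.
elim: p => [|t' u'|p IH|p IHp q IHq|p IHp q IHq|p IHp q IHq|n p IH|n p IH] //=.
- by move=> _; apply; left.
- by move=> hp H; have := IH hp H; tauto.
all: move=> /andP[hp hq] H.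
all: have {}IHp := IHp hp (fun t u I => H t u (proj2 (In_cat _ _ _) (or_introl I))).
all: have {}IHq := IHq hq (fun t u I => H t u (proj2 (In_cat _ _ _) (or_intror I))).
all: tauto.
Qed.

Definition FOrs (T : Type) (F : T -> formula) (l : seq T) : formula :=
  foldr (fun a => FOr (F a)) FFalse l.

Lemma FOrs_quantifier_free T (F : T -> formula) l :
  (forall a, quantifier_free (F a)) -> quantifier_free (FOrs F l).
Proof. by move=> HF; elim: l => //= a l ->; rewrite HF. Qed.

Lemma FOrs_free_vars T (F : T -> formula) l (A : {pred nat}) :
  (forall a, List.In a l -> {subset free_vars (F a) <= A}) ->
  {subset free_vars (FOrs F l) <= A}.
Proof.
elim: l => //= a l IH H m; rewrite mem_cat => /orP[].
  by apply: H; left.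
by apply: IH => b Hb; apply: H; right.
Qed.

Lemma holds_FOrs (M : structure) (s : nat -> M) T (F : T -> formula) l :
  holds s (FOrs F l) <-> exists2 a, List.In a l & holds s (F a).
Proof.
elim: l => [|a l IH] /=; first by split=> // -[].
split=> [[H|/IH[b bl H]]|[b [<-|bl] H]].
- by exists a => //; left.
- by exists b => //; right.
- by left.
- by right; apply/IH; exists b.
Qed.

(** * Separating a variable in a term *)

(* Exponent of [x] in the numerator ([b = false]) or the denominator
   ([b = true]) of [t]. *)
Fixpoint deg (x : nat) (b : bool) (t : term) : nat :=
  match t with
  | TVar y => (y == x) && ~~ b
  | TZero | TOne => 0
  | TMul t u => deg x b t + deg x b u
  | TInv t => deg x (~~ b) t
  end.

Fixpoint subst_const (x : nat) (c : term) (t : term) : term :=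
  match t with
  | TVar y => if y == x then c else TVar y
  | TMul t u => TMul (subst_const x c t) (subst_const x c u)
  | TInv t => TInv (subst_const x c t)
  | t => t
  end.

(** For [x != 0], setting [x] to 1 leaves the cofactor of the power of [x] in a term. *)
Definition coef x := subst_const x TOne.

Definition TPow (t : term) (n : nat) : term := iter n (TMul t) TOne.

(* Exponent of [x] on the side of [t] once denominators are cleared in [t = u]. *)
Definition ldeg x t u := (deg x false t + deg x true u)%N.

(* Subtraction is truncated, so this is the distance of the two exponents. *)
Definition root_exp x t u : nat :=
  ((ldeg x t u - ldeg x u t) + (ldeg x u t - ldeg x t u))%N.

(** The side with the larger exponent supplies the denominator, so the root equation has a positive
    exponent. Equal exponents give a meaningless value, which [root_case] discards. *)
Definition root_val x t u : term :=
  if (ldeg x u t < ldeg x t u)%N then TMul (coef x u) (TInv (coef x t))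
  else TMul (coef x t) (TInv (coef x u)).

(** * The formula replacing an existential quantifier *)

Definition atom_at_zero x t u :=
  FEq (subst_const x TZero t) (subst_const x TZero u).

(** With unequal exponents, an atom that holds at a nonzero point other than its root has both
    coefficients zero. *)
Definition atom_at_generic x t u :=
  if ldeg x t u == ldeg x u t then FEq (coef x t) (coef x u)
  else FAnd (FEq (coef x t) TZero) (FEq (coef x u) TZero).

(** This is the [m]-th power of the cleared atom [x ^ i * U = x ^ j * V], with [x ^ m] replaced by
    [w]. *)
Definition atom_at_root x m w t u :=
  FEq (TMul (TPow w (ldeg x t u)) (TPow (coef x t) m))
      (TMul (TPow w (ldeg x u t)) (TPow (coef x u) m)).

(** Exponent 0 means that the atom has no root. The value [w = 0] is excluded because the point 0 is
    left to [atom_at_zero]. *)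
Definition root_case x p (a : term * term) : formula :=
  let m := root_exp x a.1 a.2 in
  let w := root_val x a.1 a.2 in
  if m == 0%N then FFalse
  else FAnd (FNot (FEq w TZero)) (map_atoms (atom_at_root x m w) p).

Definition elim_ex x p : formula :=
  FOr (map_atoms (atom_at_zero x) p)
      (FOr (map_atoms (atom_at_generic x) p) (FOrs (root_case x p) (atoms p))).

Fixpoint qe (p : formula) : formula :=
  match p with
  | FNot p => FNot (qe p)
  | FAnd p q => FAnd (qe p) (qe q)
  | FOr p q => FOr (qe p) (qe q)
  | FImp p q => FImp (qe p) (qe q)
  | FAll n p => FNot (elim_ex n (FNot (qe p)))
  | FEx n p => elim_ex n (qe p)
  | p => p
  end.

Lemma term_vars_TPow t n : {subset term_vars (TPow t n) <= term_vars t}.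
Proof. by elim: n => //= n IH m; rewrite mem_cat => /orP[|/IH]. Qed.

Lemma term_vars_subst_const x c t : term_vars c = [::] ->
  {subset term_vars (subst_const x c t) <= [pred m in term_vars t | m != x]}.
Proof.
move=> c0; elim: t => [y|||t IHt u IHu|t IHt] //=.
  case: eqP => [_|/eqP yx] m; first by rewrite c0.
  by rewrite !inE => /eqP ->; rewrite eqxx.
by move=> m; rewrite !inE !mem_cat => /orP[/IHt|/IHu] /andP[-> ->]; rewrite ?orbT.
Qed.

Lemma term_vars_root_val x t u :
  {subset term_vars (root_val x t u)
     <= [pred m in term_vars t ++ term_vars u | m != x]}.
Proof.
move=> m; rewrite /root_val /coef; case: ifP => _ /=; rewrite mem_cat !inE mem_cat.
all: by case/orP=> /term_vars_subst_const => /(_ erefl) /andP[-> ->]; rewrite ?orbT.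
Qed.

Lemma elim_ex_quantifier_free x p : quantifier_free (elim_ex x p).
Proof.
rewrite /elim_ex /= !map_atoms_quantifier_free //= => [|t u]; last first.
  by rewrite /atom_at_generic; case: ifP.
apply: FOrs_quantifier_free => a; rewrite /root_case; case: ifP => //= _.
exact: map_atoms_quantifier_free.
Qed.

Lemma elim_ex_free_vars x p : quantifier_free p ->
  {subset free_vars (elim_ex x p) <= [pred m in free_vars p | m != x]}.
Proof.
move=> hp.
have Hs c t u : term_vars c = [::] -> List.In (t, u) (atoms p) ->
    {subset term_vars (subst_const x c t) ++ term_vars (subst_const x c u)
       <= [pred m in free_vars p | m != x]}.
  move=> c0 /atoms_free_vars/(_ hp) H m; rewrite mem_cat inE.
  case/orP=> /(term_vars_subst_const c0)/andP[Hm ->];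
    by rewrite H // mem_cat Hm ?orbT.
move=> m; rewrite /elim_ex /= !mem_cat => /or3P[].
- by apply: map_atoms_free_vars => // t u; apply: (Hs TZero).
- apply: map_atoms_free_vars => // t u I; have := Hs TOne _ _ erefl I.
  by rewrite /atom_at_generic; case: ifP => //= _; rewrite !cats0.
apply: FOrs_free_vars => -[t u] I {}m; rewrite /root_case /=.
case: ifP => //= _.
set w := root_val x t u.
have Hw : {subset term_vars w <= [pred m in free_vars p | m != x]}.
  move=> k /term_vars_root_val /andP[Hk kx].
  by rewrite inE kx (atoms_free_vars I).
rewrite cats0 mem_cat => /orP[/Hw //|].
apply: map_atoms_free_vars => // t' u' I' k /=; have H := Hs TOne _ _ erefl I'.
rewrite !mem_cat => /orP[] /orP[] /term_vars_TPow; [exact: Hw| |exact: Hw|].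
all: by move=> Hk; apply: H; rewrite mem_cat Hk ?orbT.
Qed.

Lemma qe_quantifier_free p : quantifier_free (qe p).
Proof.
elim: p => // [p IHp q IHq|p IHp q IHq|p IHp q IHq|n p IH|n p IH].
1-3: by rewrite /= IHp IHq.
- exact: (elim_ex_quantifier_free n (FNot (qe p))).
- exact: elim_ex_quantifier_free.
Qed.

Lemma qe_free_vars p : {subset free_vars (qe p) <= free_vars p}.
Proof.
elim: p => [|t u|p IH|p IHp q IHq|p IHp q IHq|p IHp q IHq|n p IH|n p IH] // m.
1-3: by rewrite /= !mem_cat => /orP[/IHp|/IHq] ->; rewrite ?orbT.
- move/(@elim_ex_free_vars n (FNot (qe p)) (qe_quantifier_free p)).
  by case/andP => /= /IH Hm mn; rewrite mem_filter mn.
- move/(elim_ex_free_vars (qe_quantifier_free p)).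
  by case/andP => /= /IH Hm mn; rewrite mem_filter mn.
Qed.

(** * Evaluation in the nonnegative reals *)

Section NonnegativeReals.
Variable R : realType.
Notation M := (nnreal_structure R).
Implicit Types (s : nat -> M) (c : M) (t u : term).

Definition rval (c : M) : R := val (c : nnreal R).

Lemma rval_ge0 c : 0 <= rval c. Proof. exact: valP. Qed.

Lemma rval_inj c d : c = d <-> rval c = rval d.
Proof. by split=> [->//|H]; apply: val_inj. Qed.

Lemma rval0 : rval (nnreal0 R) = 0. Proof. by []. Qed.

Lemma rval1 : rval (nnreal1 R) = 1. Proof. by []. Qed.

Lemma rval_mul c d : rval (nnreal_mul c d) = rval c * rval d. Proof. by []. Qed.

Lemma rval_inv c : rval (nnreal_inv c) = (rval c)^-1. Proof. by []. Qed.

Lemma rval_TPow s t n : rval (eval s (TPow t n)) = rval (eval s t) ^+ n.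
Proof. by elim: n => //= n IH; rewrite rval_mul IH exprS. Qed.

Lemma eval_subst_const s x k t :
  eval s (subst_const x k t) = eval (update s x (eval s k)) t.
Proof.
elim: t => //= [y|t -> u ->|t ->] //.
by rewrite /update; case: eqP.
Qed.

(** Inversion is multiplicative and involutive even at 0, so the induction needs no case distinction
    on vanishing subterms. *)
Lemma rval_coef s x c t : rval c != 0 ->
  rval (eval (update s x c) t) =
  rval c ^+ deg x false t / rval c ^+ deg x true t * rval (eval s (coef x t)).
Proof.
move=> c0; elim: t => [y|||t IHt u IHu|t IHt] /=.
- rewrite /update /coef /=; case: eqP => _ /=; last by rewrite divr1 mul1r.
  by rewrite rval1 divr1 mulr1.
- by rewrite rval0 mulr0.
- by rewrite divr1 mul1r.
- by rewrite !rval_mul IHt IHu !exprD invfM mulrACA [X in X * _]mulrACA.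
- by rewrite !rval_inv IHt !invfM invrK [_^-1 * _ in LHS]mulrC.
Qed.

(** Cross-multiplication: the denominators are powers of the nonzero [rval c]. *)
Lemma atom_eqP s x c t u : rval c != 0 ->
  eval (update s x c) t = eval (update s x c) u <->
  rval c ^+ ldeg x t u * rval (eval s (coef x t)) =
  rval c ^+ ldeg x u t * rval (eval s (coef x u)).
Proof.
move=> c0; rewrite rval_inj !rval_coef // /ldeg !exprD.
set P := rval (eval _ _); set Q := rval (eval _ (coef x u)).
rewrite -(mulrA _ _ P) -(mulrA _ _ Q) ![_^-1 * _]mulrC !mulrA.
split=> [/eqP|H]; last apply/eqP.
  rewrite eqr_div ?expf_neq0 // => /eqP H.
  by rewrite mulrAC H mulrAC.
by rewrite eqr_div ?expf_neq0 // mulrAC H mulrAC.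
Qed.

(* By [invr0], [V / U] vanishes also when [U = 0]. *)
Lemma monomial_eq_generic (c U V : R) i j :
  c != 0 -> (j < i)%N -> c ^+ (i - j) <> V / U ->
  c ^+ i * U = c ^+ j * V <-> U = 0 /\ V = 0.
Proof.
move=> c0 ji; rewrite -{2}(subnKC (ltnW ji)) exprD -mulrA => cW.
split=> [/(mulfI (expf_neq0 _ c0)) E|[-> ->]]; last by rewrite !mulr0.
have [U0|U0] := eqVneq U 0; first by rewrite -E U0 mulr0.
by case: cW; rewrite -E mulfK.
Qed.

Lemma atom_at_rootP s x m w c t u :
  (0 < m)%N -> rval c != 0 -> rval c ^+ m = rval (eval s w) ->
  holds s (atom_at_root x m w t u) <->
  eval (update s x c) t = eval (update s x c) u.
Proof.
move=> m0 c0 cw; rewrite atom_eqP // /= rval_inj !rval_mul !rval_TPow -cw.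
rewrite -!exprM ![(m * _)%N]mulnC !exprM -!exprMn.
split=> [|-> //] H; apply/eqP; rewrite -(eqrXn2 m0) ?H //.
all: by rewrite mulr_ge0 ?exprn_ge0 ?rval_ge0.
Qed.

Lemma atom_at_genericP s x c t u : rval c != 0 ->
  (root_exp x t u != 0%N ->
   rval c ^+ root_exp x t u <> rval (eval s (root_val x t u))) ->
  holds s (atom_at_generic x t u) <->
  eval (update s x c) t = eval (update s x c) u.
Proof.
move=> c0; rewrite atom_eqP // /atom_at_generic /root_exp /root_val.
set i := ldeg x t u; set j := ldeg x u t.
set U := eval s (coef x t); set V := eval s (coef x u).
case: (ltngtP i j) => [ij|ji|<-] /=; rewrite -/U -/V.
(* Here [j] is the larger exponent, so the atom is read from right to left. *)
- rewrite (eqP (ltnW ij : (i - j == 0)%N)) add0n -lt0n subn_gt0 => /(_ ij).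
  rewrite rval_mul rval_inv !rval_inj rval0 => /(monomial_eq_generic c0 ij) E.
  by split=> [[U0 V0]|/esym/E[-> ->]] //; apply/esym/E.
- rewrite (eqP (ltnW ji : (j - i == 0)%N)) addn0 -lt0n subn_gt0 => /(_ ji).
  rewrite rval_mul rval_inv !rval_inj rval0 => /(monomial_eq_generic c0 ji) E.
  exact: iff_sym.
- move=> _; rewrite rval_inj; split=> [-> //|].
  exact: (mulfI (expf_neq0 _ c0)).
Qed.

(** * Existence of roots and of generic points *)

Lemma nnreal_root m c : (0 < m)%N -> exists d : M, rval d ^+ m = rval c.
Proof.
move=> m0; have c0 := rval_ge0 c.
(* The endpoint [1 + rval c] is at least 1, so its [m]-th power is at least itself and exceeds
   [rval c]. *)
have [| |z /andP[z0 _] /rootP H] :=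
  @poly_ivt R ('X^m - (rval c)%:P) 0 (1 + rval c).
- by rewrite addr_ge0.
- rewrite !hornerE expr0n gtn_eqF //= sub0r oppr_le0 c0 /= subr_ge0.
  apply: (@le_trans _ _ (1 + rval c)); first by rewrite lerDr.
  by rewrite ler_eXnr // lerDl.
exists (exist _ z z0 : nnreal R); rewrite /rval /=.
by move/eqP: H; rewrite !hornerE subr_eq0 => /eqP.
Qed.

(** Any [b >= 1] above all the values [f a] will do, since [b ^ e >= b] for [e > 0]. *)
Lemma generic_point (T : Type) (e : T -> nat) (f : T -> M) l :
  exists2 c : M, rval c != 0 &
    forall a, List.In a l -> e a != 0%N -> rval c ^+ e a <> rval (f a).
Proof.
have [b b1 Hb] : exists2 b : R, 1 <= b & forall a, List.In a l -> rval (f a) < b.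
  elim: l => [|a l [b b1 Hb]]; first by exists 1.
  exists (b + rval (f a)) => [|a' [<-|/Hb H]].
  - by rewrite ler_wpDr ?rval_ge0.
  - by rewrite ltrDr (lt_le_trans ltr01).
  - by rewrite ltr_wpDr ?rval_ge0.
exists (exist _ b (le_trans ler01 b1) : nnreal R) => [|a al ea] /=.
  by rewrite /rval /= gt_eqF // (lt_le_trans ltr01).
apply/eqP; rewrite gt_eqF // (lt_le_trans (Hb _ al)) //.
by rewrite /rval /= ler_eXnr // lt0n.
Qed.

(** * Correctness of the elimination *)

Lemma elim_exP s x p : quantifier_free p ->
  holds s (elim_ex x p) <-> exists c : M, holds (update s x c) p.
Proof.
move=> hp.
have zeroP : holds s (map_atoms (atom_at_zero x) p) <->
    holds (update s x (zero_ M)) p.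
  by apply: holds_map_atoms => // t u _; rewrite /= !eval_subst_const.
have genP c : rval c != 0 ->
    (forall a, List.In a (atoms p) -> root_exp x a.1 a.2 != 0%N ->
       rval c ^+ root_exp x a.1 a.2 <> rval (eval s (root_val x a.1 a.2))) ->
    holds s (map_atoms (atom_at_generic x) p) <-> holds (update s x c) p.
  move=> c0 Hc; apply: holds_map_atoms => // t u I.
  exact: (atom_at_genericP c0 (Hc _ I)).
have rootP m w c : (0 < m)%N -> rval c != 0 -> rval c ^+ m = rval (eval s w) ->
    holds s (map_atoms (atom_at_root x m w) p) <-> holds (update s x c) p.
  by move=> *; apply: holds_map_atoms => // t u _; apply: atom_at_rootP.
split=> [[H|[H|/holds_FOrs[[t u] I]]]|[c Hc]].
- by exists (zero_ M); apply/zeroP.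
- have [c c0 Hc] := generic_point (fun a => root_exp x a.1 a.2)
    (fun a => eval s (root_val x a.1 a.2)) (atoms p).
  by exists c; apply/genP.
- rewrite /root_case /=; case: eqP => //= /eqP; rewrite -lt0n => m0 [w0].
  have [c cw] := nnreal_root (eval s (root_val x t u)) m0.
  (* The conjunct [w != 0] of [root_case] makes the root nonzero, as the exponent is positive. *)
  have c0 : rval c != 0.
    apply/eqP => c0; apply: w0; apply/rval_inj.
    by rewrite -cw c0 expr0n gtn_eqF.
  by move=> H; exists c; apply/(rootP _ _ c m0 c0 cw).
have [c0|c0] := eqVneq (rval c) 0.
  left; apply/zeroP; suff <- : c = zero_ M by [].
  exact/rval_inj.
(* The witness [c] either is the root of some atom of [p] or is itself generic. *)
right; have [[a aI [m0 Ha]]|nroot] := pselect (exists2 a, List.In a (atoms p) &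
    root_exp x a.1 a.2 != 0%N /\
    rval c ^+ root_exp x a.1 a.2 = rval (eval s (root_val x a.1 a.2))).
  right; apply/holds_FOrs; exists a => //; rewrite /root_case (negbTE m0) /=.
  split.
    move/rval_inj; rewrite -Ha => /eqP.
    by rewrite /rval /= expf_eq0 (negbTE c0) andbF.
  by apply/(rootP _ _ c) => //; rewrite lt0n.
by left; apply/(genP c) => // a aI m0 Ha; apply: nroot; exists a.
Qed.

Lemma qeP p s : holds s p <-> holds s (qe p).
Proof.
elim: p s => [|t u|p IH|p IHp q IHq|p IHp q IHq|p IHp q IHq|n p IH|n p IH] s //.
- by have := IH s => /=; tauto.
1-3: by have := IHp s; have := IHq s => /=; tauto.
- rewrite [X in _ <-> X]/(~ holds s (elim_ex n (FNot (qe p)))).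
  rewrite elim_exP /= ?qe_quantifier_free //.
  split=> [H [c Hc]|H c]; first by apply/Hc/IH/H.
  (* Classically, the absence of a counterexample gives the universal statement. *)
  by apply: contrapT => Hc; apply: H; exists c => /IH.
- rewrite [qe _]/(elim_ex n (qe p)) elim_exP ?qe_quantifier_free //.
  by split=> -[c Hc]; exists c; apply/IH.
Qed.

End NonnegativeReals.

Theorem theorem8 (R : realType) :
  admits_quantifier_elimination (theory_of (nnreal_structure R)).
Proof.
move=> p; exists (qe p); split.
- exact: qe_quantifier_free.
- exact: qe_free_vars.
apply: entails_theory_of => s; exact: qeP.
Qed.
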